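(* For every $g \geq 2$, the fundamental group $\Pi_g$ of a compact Riemann surface of genus $g$ enjoys property NINF: every non-trivial normal subgroup of infinite index in $\Pi_g$ is not finitely generated.
   Context: A group $G$ satisfies property NINF if every normal non-trivial subgroup $K$ of $G$ of infinite index is not finitely generated. Explicitly, $\Pi_g = \langle a_1,\dots,a_g,b_1,\dots,b_g \mid [a_1,b_1]\cdots[a_g,b_g]=1\rangle$. *)

(* Defs.v *)
From HB Require Import structures.
From mathcomp Require Import all_boot.
From mathcomp Require Import boolp classical_sets cardinality.

Set Implicit Arguments.
Unset Strict Implicit.
Unset Printing Implicit Defensive.

Local Open Scope classical_set_scope.
Local Open Scope group_scope.
Local Open Scope quotient_scope.

(* Words over X and formal inverses of X: the letter (x, false) stands for x
   and the letter (x, true) for x^-1. *)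
Definition word (X : Type) := seq (X * bool).

Definition inv_letter (X : Type) (l : X * bool) : X * bool := (l.1, ~~ l.2).

Definition inv_word (X : Type) (w : word X) : word X :=
  rev [seq inv_letter l | l <- w].

Inductive word_equiv (X : Type) (R : set (word X)) : word X -> word X -> Prop :=
| word_equiv_refl u : word_equiv R u u
| word_equiv_sym u v : word_equiv R u v -> word_equiv R v u
| word_equiv_trans u v w :
    word_equiv R u v -> word_equiv R v w -> word_equiv R u w
| word_equiv_cancel u v l :
    word_equiv R (u ++ [:: l; inv_letter l] ++ v) (u ++ v)
| word_equiv_relator u v r : R r -> word_equiv R (u ++ r ++ v) (u ++ v).

Section PresentedGroup.
Variables (X : choiceType) (R : set (word X)).

Definition word_equivb : rel (word X) := fun u v => `[< word_equiv R u v >].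

Lemma word_equivb_refl : reflexive word_equivb.
Proof. by move=> u; apply/asboolP; exact: word_equiv_refl. Qed.

Lemma word_equivb_sym : symmetric word_equivb.
Proof.
by move=> u v; apply/asboolP/asboolP => ?; exact: word_equiv_sym.
Qed.

Lemma word_equivb_trans : transitive word_equivb.
Proof.
move=> v u w /asboolP uv /asboolP vw; apply/asboolP.
exact: word_equiv_trans uv vw.
Qed.

Definition word_equivr :=
  EquivRel word_equivb word_equivb_refl word_equivb_sym word_equivb_trans.

(* The group < X | r = 1, r in R >. *)
Definition presented_group := {eq_quot word_equivr}.

HB.instance Definition _ := Choice.on presented_group.

Definition presented_class (u : word X) : presented_group :=
  \pi_({eq_quot word_equivr}) u.

Definition presented_repr (x : presented_group) : word X := repr x.

Lemma presented_reprK x : presented_class (presented_repr x) = x.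
Proof. exact: reprK. Qed.

Lemma presented_eqP (u v : word X) :
  presented_class u = presented_class v <-> word_equiv R u v.
Proof.
by split=> [/eqmodP/asboolP //|uv]; apply/eqmodP/asboolP.
Qed.

Lemma presentedW (P : presented_group -> Prop) :
  (forall u, P (presented_class u)) -> forall x, P x.
Proof. by move=> Pu x; rewrite -(presented_reprK x). Qed.

Lemma word_equiv_catl w u v : word_equiv R u v -> word_equiv R (w ++ u) (w ++ v).
Proof.
elim=> {u v} [u|u v _|u v t _ uv _ vt|u v l|u v r Rr].
- exact: word_equiv_refl.
- exact: word_equiv_sym.
- exact: word_equiv_trans uv vt.
- by rewrite !(catA w); exact: word_equiv_cancel.
- by rewrite !(catA w); exact: word_equiv_relator.
Qed.

Lemma word_equiv_catr w u v : word_equiv R u v -> word_equiv R (u ++ w) (v ++ w).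
Proof.
elim=> {u v} [u|u v _|u v t _ uv _ vt|u v l|u v r Rr].
- exact: word_equiv_refl.
- exact: word_equiv_sym.
- exact: word_equiv_trans uv vt.
- by rewrite -!catA; exact: word_equiv_cancel.
- by rewrite -!catA; exact: word_equiv_relator.
Qed.

Lemma inv_letterK : involutive (@inv_letter X).
Proof. by case=> x b; rewrite /inv_letter /= negbK. Qed.

Lemma inv_wordK : involutive (@inv_word X).
Proof.
move=> w; rewrite /inv_word map_rev revK -map_comp map_id_in // => l _.
exact: inv_letterK.
Qed.

Lemma inv_word_cat (u v : word X) : inv_word (u ++ v) = inv_word v ++ inv_word u.
Proof. by rewrite /inv_word map_cat rev_cat. Qed.

Lemma word_equiv_mulV w : word_equiv R (w ++ inv_word w) [::].
Proof.
elim: w => [|l w IH]; first exact: word_equiv_refl.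
rewrite -cat1s inv_word_cat -catA (catA w).
apply: word_equiv_trans (word_equiv_catl _ (word_equiv_catr _ IH)) _.
exact: (word_equiv_cancel R [::] [::] l).
Qed.

Lemma word_equiv_Vmul w : word_equiv R (inv_word w ++ w) [::].
Proof. by have := word_equiv_mulV (inv_word w); rewrite inv_wordK. Qed.

Lemma word_equiv_inv u v :
  word_equiv R u v -> word_equiv R (inv_word u) (inv_word v).
Proof.
move=> uv; apply: (@word_equiv_trans _ _ _ (inv_word u ++ v ++ inv_word v)).
  rewrite -{1}(cats0 (inv_word u)); apply/word_equiv_catl/word_equiv_sym.
  exact: word_equiv_mulV.
rewrite catA -{2}(cat0s (inv_word v)); apply: word_equiv_catr.
apply: word_equiv_trans (word_equiv_Vmul u).
exact/word_equiv_catl/word_equiv_sym.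
Qed.

Definition presented_one : presented_group := presented_class [::].

Definition presented_mul (x y : presented_group) : presented_group :=
  presented_class (presented_repr x ++ presented_repr y).

Definition presented_inv (x : presented_group) : presented_group :=
  presented_class (inv_word (presented_repr x)).

Lemma word_equiv_repr u : word_equiv R (presented_repr (presented_class u)) u.
Proof. by apply/presented_eqP; rewrite presented_reprK. Qed.

Lemma presented_mulE u v :
  presented_mul (presented_class u) (presented_class v)
  = presented_class (u ++ v).
Proof.
apply/presented_eqP.
apply: word_equiv_trans (word_equiv_catl _ (word_equiv_repr v)) _.
exact/word_equiv_catr/word_equiv_repr.
Qed.

Lemma presented_invE u :
  presented_inv (presented_class u) = presented_class (inv_word u).
Proof. exact/presented_eqP/word_equiv_inv/word_equiv_repr. Qed.

Lemma presented_mulA : associative presented_mul.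
Proof.
elim/presentedW=> u; elim/presentedW=> v; elim/presentedW=> w.
by rewrite !presented_mulE catA.
Qed.

Lemma presented_mul1 : left_id presented_one presented_mul.
Proof. by elim/presentedW=> u; rewrite presented_mulE. Qed.

Lemma presented_mulr1 : right_id presented_one presented_mul.
Proof. by elim/presentedW=> u; rewrite presented_mulE cats0. Qed.

Lemma presented_mulVg : left_inverse presented_one presented_inv presented_mul.
Proof.
elim/presentedW=> u; rewrite presented_invE presented_mulE.
exact/presented_eqP/word_equiv_Vmul.
Qed.

Lemma presented_mulgV : right_inverse presented_one presented_inv presented_mul.
Proof.
elim/presentedW=> u; rewrite presented_invE presented_mulE.
exact/presented_eqP/word_equiv_mulV.
Qed.

HB.instance Definition _ := isGroup.Build presented_group
  presented_mulA presented_mul1 presented_mulr1 presented_mulVg presented_mulgV.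

End PresentedGroup.

(* The generators of Pi_g: inl i is a_i and inr i is b_i. *)
Definition surface_gen (g : nat) : choiceType := ('I_g + 'I_g)%type.

(* [a_i, b_i] = a_i b_i a_i^-1 b_i^-1 *)
Definition surface_comm (g : nat) (i : 'I_g) : word (surface_gen g) :=
  [:: (inl i, false); (inr i, false); (inl i, true); (inr i, true)].

Definition surface_relator (g : nat) : word (surface_gen g) :=
  flatten [seq surface_comm i | i <- enum 'I_g].

Definition surface_group (g : nat) : groupType :=
  presented_group [set surface_relator g].

Section Subgroups.
Variable G : groupType.

Definition subgroup (K : set G) : Prop := group_closed [in K].

Definition normal_subgroup (K : set G) : Prop :=
  subgroup K /\ forall x y : G, K x -> K (x ^ y).

Definition finitely_generated (K : set G) : Prop :=
  exists2 A : set G, finite_set A & K = smallest subgroup A.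

Definition left_coset (K : set G) (x : G) : set G := [set x * k | k in K].

Definition infinite_index (K : set G) : Prop :=
  infinite_set (range (left_coset K)).

End Subgroups.

Definition NINF (G : groupType) : Prop :=
  forall K : set G, normal_subgroup K -> K <> [set 1] -> infinite_index K ->
    ~ finitely_generated K.

(* Main.v *)
(* Let t = b_0, let chi : G -> Z count the exponent of t, and let K be a
   finitely generated normal subgroup of infinite index of G = Pi_g, g >= 2.

   If chi vanishes on K, then K is trivial. The kernel of chi is free on a_0 and
   the conjugates t^n x t^-n of the other generators, and K is contained in the
   subgroup spanned by finitely many of these; conjugation by one more free
   generator would move K out of that subgroup.

   If chi s <> 0 for some s in K, consider the module M of finitely supported
   rational-valued functions on G/K, where G acts by translation twisted by the
   character mu = 2^chi. As K is finitely generated and G/K is infinite, every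
   derivation d : G -> M vanishes on K :&: ker chi; then s, which acts on M by a
   scalar <> 1, forces d to be principal. But Poincare duality associates to
   e = [s, a_1] in K a derivation d which is not principal: the sum of the
   values of d b_1 is 1 - mu(s)^-1 <> 0, whereas it would be a multiple of
   1 - mu b_1 = 0 for a principal d. *)

From HB Require Import structures.
Require Import Defs.
From mathcomp Require Import all_boot all_order all_algebra.
From mathcomp Require Import boolp classical_sets cardinality fsbigop functions.
From mathcomp Require Import zify.

Set Implicit Arguments.
Unset Strict Implicit.
Unset Printing Implicit Defensive.

Import Order.TTheory GRing.Theory Num.Theory.

Local Open Scope classical_set_scope.
Local Open Scope group_scope.

(** * Actions of a group given by a presentation *)

Section PresentedGroupTheory.
Variables (X : choiceType) (R : set (word X)).
Local Notation G := (presented_group R).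
Local Notation cls := (presented_class R).

Definition presented_gen (x : X) : G := cls [:: (x, false)].

Lemma presented_class_cat u v : cls (u ++ v) = cls u * cls v.
Proof. by rewrite -presented_mulE. Qed.

Lemma presented_class_inv w : cls (inv_word w) = (cls w)^-1.
Proof. by rewrite -presented_invE. Qed.

Lemma presented_class_letter x b :
  cls [:: (x, b)] = if b then (presented_gen x)^-1 else presented_gen x.
Proof. by case: b => //; rewrite -presented_class_inv. Qed.

Lemma presented_class_cons x b w : cls ((x, b) :: w) =
  (if b then (presented_gen x)^-1 else presented_gen x) * cls w.
Proof. by rewrite -cat1s presented_class_cat presented_class_letter. Qed.

Lemma presented_relator r : R r -> cls r = 1.
Proof.
by move=> Rr; apply/presented_eqP; rewrite -[r]cats0; apply: (word_equiv_relator [::]).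
Qed.

Lemma presented_ind (P : G -> Prop) :
  P 1 -> (forall g h, P g -> P h -> P (g * h)) -> (forall g, P g -> P g^-1) ->
  (forall x, P (presented_gen x)) -> forall g, P g.
Proof.
move=> P1 PM PV Px; elim/presentedW; elim=> [|[x b] w IHw]; first exact: P1.
rewrite presented_class_cons; apply: PM => //; case: b => //; exact: PV.
Qed.

Section Action.
Variables (T : Type) (f : X * bool -> T -> T).
Hypothesis fK : forall l p, f l (f (inv_letter l) p) = p.
Hypothesis fR : forall r p, R r -> foldr f p r = p.

(** Universal property of the presentation, for actions: under [fK] and [fR] the result does not
    depend on the word chosen for [g]. The character [chi], the affine action and the derivations
    below all arise this way. *)
Definition presented_act (g : G) (p : T) : T := foldr f p (presented_repr g).

Lemma presented_act_class w p : presented_act (cls w) p = foldr f p w.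
Proof.
rewrite /presented_act; move: (word_equiv_repr R w); move: (presented_repr _).
move=> u uw; elim: uw p => {u w} //.
- by move=> u v w _ uv _ vw p; rewrite uv.
- by move=> u v l p; rewrite !foldr_cat /= fK.
- by move=> u v r Rr p; rewrite !foldr_cat (fR _ Rr).
Qed.

Lemma presented_act1 p : presented_act 1 p = p.
Proof. exact: presented_act_class [::] p. Qed.

Lemma presented_actM g h p :
  presented_act (g * h) p = presented_act g (presented_act h p).
Proof.
elim/presentedW: g => u; elim/presentedW: h => v.
by rewrite -presented_class_cat !presented_act_class foldr_cat.
Qed.

Lemma presented_act_gen x p : presented_act (presented_gen x) p = f (x, false) p.
Proof. exact: presented_act_class. Qed.

Lemma presented_act_genV x p :
  presented_act (presented_gen x)^-1 p = f (x, true) p.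
Proof. by rewrite -presented_class_inv presented_act_class. Qed.

End Action.
End PresentedGroupTheory.

(** * The surface relator, split after its first commutator *)

Section SurfaceGroup.
Variable h : nat.
Local Notation g := h.+2.
Local Notation G := (surface_group g).
Local Notation gen := (@presented_gen (surface_gen g) [set surface_relator g]).
Local Notation cls := (presented_class [set surface_relator g]).

Definition second : 'I_g := lift ord0 ord0.
Definition surface_tail : word (surface_gen g) :=
  flatten [seq surface_comm (lift ord0 i) | i <- enum 'I_h.+1].

Lemma surface_relatorE :
  surface_relator g = surface_comm (ord0 : 'I_g) ++ surface_tail.
Proof.
by rewrite /surface_relator /surface_tail enum_ordSl /= -map_comp.
Qed.

Lemma surface_tail_letter l : l \in surface_tail -> exists i : 'I_h.+1,
  l.1 = inl (lift ord0 i) \/ l.1 = inr (lift ord0 i).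
Proof.
case/flattenP=> s /mapP [i _ ->]; rewrite !inE => hl; exists i.
by case/or4P: hl => /eqP ->; [left|right|left|right].
Qed.

Lemma surface_comm_class i : cls (surface_comm i) =
  gen (inl i) * gen (inr i) * (gen (inl i))^-1 * (gen (inr i))^-1 :> G.
Proof. by rewrite !presented_class_cons mulg1 !mulgA. Qed.

End SurfaceGroup.

(** * The action detecting normal subgroups of ker chi *)

Section LevelAction.
Variable h : nat.
Local Notation g := h.+2.
Local Notation G := (surface_group g).
Local Notation gen := (@presented_gen (surface_gen g) [set surface_relator g]).
Local Notation cls := (presented_class [set surface_relator g]).
Local Notation t := (inr ord0 : surface_gen g).

Definition chi_letter (l : surface_gen g * bool) (n : int) : int :=
  (if l.1 == t then if l.2 then n - 1 else n + 1 else n)%R.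

Lemma chi_letterK l n : chi_letter l (chi_letter (inv_letter l) n) = n.
Proof. by case: l => x [] /=; rewrite /chi_letter /=; case: eqP => //= _; lia. Qed.

Lemma chi_letter_tail n : foldr chi_letter n (surface_tail h) = n.
Proof.
suff H w : (forall l, l \in w -> exists i : 'I_h.+1,
    l.1 = inl (lift ord0 i) \/ l.1 = inr (lift ord0 i)) ->
    foldr chi_letter n w = n by apply: H; exact: surface_tail_letter.
elim: w => //= l w IH H; rewrite IH => [|l' l'w]; last first.
  by apply: H; rewrite inE l'w orbT.
rewrite /chi_letter; case: eqP => // lt.
by have [i [|]] := H l (mem_head _ _); rewrite lt // => -[].
Qed.

Lemma chi_letter_relator r n :
  [set surface_relator g] r -> foldr chi_letter n r = n.
Proof.
move=> ->; rewrite surface_relatorE foldr_cat chi_letter_tail /chi_letter /=.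
lia.
Qed.

Definition chi (x : G) : int := presented_act chi_letter x 0%R.

Lemma chi_act x n : presented_act chi_letter x n = (chi x + n)%R.
Proof.
rewrite /chi; elim/presentedW: x => w.
rewrite !(presented_act_class chi_letterK chi_letter_relator).
elim: w => [|l w /= ->]; first by rewrite /= add0r.
by rewrite /chi_letter; case: eqP => // _; case: l.2; lia.
Qed.

Lemma chiM x y : chi (x * y) = (chi x + chi y)%R.
Proof.
rewrite {1}/chi (presented_actM chi_letterK chi_letter_relator).
by rewrite chi_act.
Qed.

Lemma chi1 : chi 1 = 0%R. Proof. by have := chiM 1 1; rewrite mulg1; lia. Qed.

Lemma chiV x : chi x^-1 = (- chi x)%R.
Proof. by have := chiM x x^-1; rewrite mulgV chi1; lia. Qed.

Lemma chi_gen x : chi (gen x) = (x == t).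
Proof.
rewrite /chi (presented_act_gen chi_letterK chi_letter_relator) /chi_letter /=.
by case: eqP.
Qed.

(* A point (n, b, u) has a level n and a sheet b. At levels n > 0, G acts by left
   translation on the sheet b = false and trivially on the sheet b = true. The
   relator only requires that a_0 act at level n - 1 as the product of the other
   commutators times a_0 does at level n, hence at levels n <= 0 the other
   generators may act trivially; so may their commutators at level 0 when a_1
   exchanges the two sheets there, since b_1 acts trivially. *)
Definition level_letter (l : surface_gen g * bool) (p : int * bool * G) :
    int * bool * G :=
  let: (n, b, u) := p in
  let y := if l.2 then (gen l.1)^-1 else gen l.1 in
  if l.1 == t then
    (chi_letter l n, b,
     if ~~ b && (if l.2 then 0 < n else 0 <= n)%R then y * u else u)
  else if (n == 0%R) && (l.1 == inl (second h)) then (n, ~~ b, u)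
  else (n, b, if ~~ b && ((0 < n)%R || (l.1 == inl ord0)) then y * u else u).

Lemma level_letterK l p : level_letter l (level_letter (inv_letter l) p) = p.
Proof.
case: l => x e; case: p => [[n b] u]; rewrite /level_letter /inv_letter /=.
have [xt|xt] := eqVneq x t.
  rewrite /chi_letter /= xt eqxx.
  case: b e => [] [] /=; congr (_, _, _); try lia.
    by have [n0|n0] := leP 0%R n; [rewrite ifT ?mulKg //; lia|rewrite ifF //; lia].
  by have [n0|n0] := ltP 0%R n; [rewrite ifT ?mulVKg //; lia|rewrite ifF //; lia].
have [/andP[n0 xb]|/negbTE nx] := boolP ((n == 0%R) && (x == inl (second h))).
  by rewrite n0 xb /= negbK.
rewrite nx /=.
by case: (~~ b && _) => //; case: e; rewrite /= ?mulKg ?mulVKg.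
Qed.

Lemma level_inr (i : 'I_h.+1) e n b u :
  level_letter (inr (lift ord0 i), e) (n, b, u) =
  (n, b, if ~~ b && (0 < n)%R then cls [:: (inr (lift ord0 i), e)] * u else u).
Proof.
by rewrite /level_letter /= andbF orbF (presented_class_letter _ (inr _)).
Qed.

Lemma level_inl (i : 'I_h.+1) e n b u :
  level_letter (inl (lift ord0 i), e) (n, b, u) =
  if (n == 0%R) && (i == ord0) then (n, ~~ b, u) else
  (n, b, if ~~ b && (0 < n)%R then cls [:: (inl (lift ord0 i), e)] * u else u).
Proof.
by rewrite /level_letter /= orbF (presented_class_letter _ (inl _)).
Qed.

Lemma level_comm (i : 'I_h.+1) n b u :
  foldr level_letter (n, b, u) (surface_comm (lift ord0 i : 'I_g)) =
  (n, b, if ~~ b && (0 < n)%R then cls (surface_comm (lift ord0 i : 'I_g)) * u else u).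
Proof.
rewrite /surface_comm /foldr level_inr level_inl.
case: ifP => [/andP[/eqP n0 i0]|ni].
  (* Here [a_1] acts at level 0: it exchanges the sheets twice, while [b_1] fixes every point. *)
  by rewrite level_inr level_inl n0 i0 eqxx ltxx !andbF negbK.
rewrite level_inr level_inl ni; case: (~~ b && _) => //.
by rewrite !presented_class_letter !presented_class_cons mulg1 !mulgA.
Qed.

Lemma level_tail n b u :
  foldr level_letter (n, b, u) (surface_tail h) =
  (n, b, if ~~ b && (0 < n)%R then cls (surface_tail h) * u else u).
Proof.
rewrite /surface_tail; elim: (enum _) => [|i s IH].
  by rewrite mul1g if_same.
rewrite map_cons -[flatten (_ :: _)]/(surface_comm _ ++ flatten _).
rewrite foldr_cat IH level_comm.
by case: (~~ b && _) => //; rewrite presented_class_cat mulgA.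
Qed.

Lemma cls_surface_tail : cls (surface_tail h) = (cls (surface_comm (ord0 : 'I_g)))^-1.
Proof.
have: cls (surface_relator g) = 1 by exact: presented_relator.
by rewrite surface_relatorE presented_class_cat => /mulg1_eq.
Qed.

(** [foldr] applies the last letter first, so the tail acts before [a_0 t a_0^-1 t^-1]. On the sheet
    [false], at levels [n > 0] every letter multiplies and the relation in [G] concludes; at levels
    [n <= 0] the tail and both letters in [t] leave [u] unchanged, and [a_0^-1] at level [n - 1]
    cancels [a_0] at level [n]. *)
Lemma level_relator r p :
  [set surface_relator g] r -> foldr level_letter p r = p.
Proof.
move=> ->; case: p => [[n b] u]; rewrite surface_relatorE foldr_cat level_tail.
rewrite cls_surface_tail surface_comm_class.
rewrite /= /level_letter /chi_letter /= !eqxx !andbF !orbT !andbT.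
congr (_, _, _); first lia.
case: b => //=.
have [n0|n0] := ltP 0%R n.
  by rewrite ifT ?gnorm; last lia.
rewrite ifF ?mulVKg //; lia.
Qed.

End LevelAction.

(** * Closure properties of subgroups and induction on generated subgroups *)

Section SubgroupTheory.
Variable G : groupType.
Implicit Types K A : set G.

Lemma subgroupP K : subgroup K <->
  K 1 /\ forall x y, K x -> K y -> K (x * y^-1).
Proof.
split=> [[K1 KB]|[K1 KB]]; split.
- by move: K1; rewrite inE.
- by move=> x y Kx Ky; have := KB x y; rewrite !inE; apply.
- by rewrite inE.
- by move=> x y; rewrite !inE; exact: KB.
Qed.

Lemma smallest_subgroup_ind A (P : G -> Prop) :
  P 1 -> (forall x y, P x -> P y -> P (x * y^-1)) -> (forall x, A x -> P x) ->
  forall x, smallest (@subgroup G) A x -> P x.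
Proof.
by move=> P1 PB PA x /(_ P); apply; split=> //; apply/subgroupP.
Qed.

Lemma subgroup1 K : subgroup K -> K 1.
Proof. by case/subgroupP. Qed.

Lemma subgroupV K x : subgroup K -> K x -> K x^-1.
Proof. by case/subgroupP=> K1 KB Kx; rewrite -[x^-1]mul1g; exact: KB. Qed.

Lemma subgroupM K x y : subgroup K -> K x -> K y -> K (x * y).
Proof.
move=> sK Kx Ky; rewrite -[y]invgK; case/subgroupP: (sK) => _; apply=> //.
exact: subgroupV.
Qed.

Lemma normal_conj K x y : normal_subgroup K -> K x -> K (y * x * y^-1).
Proof. by case=> _ nK Kx; have := nK x y^-1 Kx; rewrite /conjg invgK mulgA. Qed.

End SubgroupTheory.

(** * Finitely generated normal subgroups on which [chi] vanishes *)

Section KernelCase.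
Variable h : nat.
Local Notation g := h.+2.
Local Notation G := (surface_group g).
Local Notation gen := (@presented_gen (surface_gen g) [set surface_relator g]).
Local Notation cls := (presented_class [set surface_relator g]).
Local Notation t := (inr ord0 : surface_gen g).

Definition level : G -> int * bool * G -> int * bool * G :=
  presented_act (@level_letter h).

Lemma level1 p : level 1 p = p.
Proof. exact: (presented_act1 (@level_letterK h) (@level_relator h)). Qed.

Lemma levelM x y p : level (x * y) p = level x (level y p).
Proof. exact: (presented_actM (@level_letterK h) (@level_relator h)). Qed.

Lemma levelVK x p : level x^-1 (level x p) = p.
Proof. by rewrite -levelM mulVg level1. Qed.

Lemma level_class w p : level (cls w) p = foldr (@level_letter h) p w.
Proof. exact: (presented_act_class (@level_letterK h) (@level_relator h)). Qed.

(** Each letter lowers the level by at most 1, so a word shorter than [n] stays at positive levels,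
    where every letter multiplies on the sheet [false]. The inequality is the invariant of the
    induction. *)
Lemma foldr_level_pos w (n : int) b u : ((size w)%:Z < n)%R ->
  (n - (size w)%:Z <= foldr (@chi_letter h) n w)%R /\
  foldr (@level_letter h) (n, b, u) w =
    (foldr (@chi_letter h) n w, b, if b then u else cls w * u).
Proof.
elim: w => [|[x e] w IH] /= wn.
  by split; [lia|rewrite mul1g; case: b].
set s := size w in IH wn *; have [|nw ->] := IH; first lia.
clear IH.
move: (foldr _ _ w) nw => m nw; rewrite presented_class_cons /level_letter /=.
rewrite /chi_letter /=; have [_|_] := eqVneq x t.
  split; first by case: e; lia.
  by case: b => //; case: e; rewrite /= ifT ?mulgA //; lia.
split; first lia.
have -> /= : (m == 0%R) = false by lia.
have -> /= : (0 < m)%R by lia.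
by case: b; rewrite //= mulgA.
Qed.

Lemma level_pos (x : G) (n : int) b u :
  ((size (presented_repr x))%:Z < n)%R ->
  level x (n, b, u) = ((chi x + n)%R, b, if b then u else x * u).
Proof.
move=> xn; rewrite -{1}(presented_reprK x) level_class.
have [_ ->] := @foldr_level_pos (presented_repr x) n b u xn.
by rewrite presented_reprK -chi_act.
Qed.

Lemma level_tpow (n : nat) b u :
  level (gen t ^+ n) (0%R, b, u) = (Posz n, b, if b then u else gen t ^+ n * u).
Proof.
elim: n => [|n IH]; first by rewrite level1 mul1g if_same.
rewrite expgS levelM IH /level.
rewrite (presented_act_gen (@level_letterK h) (@level_relator h)).
rewrite /level_letter /chi_letter /= -mulgA.
by congr (_, _, _); [lia|case: b {IH}].
Qed.

Lemma level_swap b u :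
  level (gen (inl (second h))) (0%R, b, u) = (0%R, ~~ b, u).
Proof.
rewrite /level (presented_act_gen (@level_letterK h) (@level_relator h)).
by rewrite /level_letter /=.
Qed.

(* At a level n above all letters of the generators of K, the elements of K
   fix the points (n, true, u) and act by left multiplication on the points
   (n, false, u); these two kinds of points are exchanged by the conjugate of
   a_1 by t^n, which normalizes K. *)
Lemma normal_fg_in_ker_chi (K : set G) : normal_subgroup K ->
  finitely_generated K -> (forall x, K x -> chi x = 0%R) -> K = [set 1].
Proof.
move=> nK [A finA KA] chiK; have sK : subgroup K by case: nK.
have AK x : A x -> K x by rewrite KA; exact: sub_gen_smallest.
(* This level exceeds the length of the representative of each generator, as [level_pos]
   requires. *)
have [n nA] : exists n : nat, forall x, A x -> size (presented_repr x) < n.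
  have /finite_seqP[s As] := finA.
  exists (\max_(x <- s) size (presented_repr x)).+1 => x; rewrite As /= => xs.
  by rewrite ltnS; apply: leq_bigmax_seq xs _.
have stdK x : K x ->
    forall b u, level x (Posz n, b, u) = (Posz n, b, if b then u else x * u).
  rewrite KA; pose P x := forall b u,
    level x (Posz n, b, u) = (Posz n, b, if b then u else x * u).
  apply: (@smallest_subgroup_ind _ A P) => {x}.
  - by move=> b u; rewrite level1 mul1g if_same.
  - move=> x y IHx IHy b u; rewrite levelM.
    have -> : level y^-1 (Posz n, b, u) = (Posz n, b, if b then u else y^-1 * u).
      rewrite -[RHS](levelVK y) IHy; congr (level _ (_, _, _)).
      by case: b; rewrite ?mulVKg.
    by rewrite IHx -mulgA; case: b.
  - move=> x Ax b u; rewrite level_pos; last by have := nA x Ax; lia.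
    by rewrite (chiK _ (AK _ Ax)) add0r.
rewrite eqEsubset; split=> [k Kk|_ ->]; last exact: subgroup1.
pose y := gen t ^+ n * gen (inl (second h)) * (gen t ^+ n)^-1.
have tn b u : level (gen t ^+ n)^-1 (Posz n, b, u) =
    (0%R, b, if b then u else (gen t ^+ n)^-1 * u).
  rewrite -[RHS](levelVK (gen t ^+ n)) level_tpow; congr (level _ (_, _, _)).
  by case: b; rewrite ?mulVKg.
have yE b u : level y (Posz n, b, u) =
    (Posz n, ~~ b, if b then gen t ^+ n * u else (gen t ^+ n)^-1 * u).
  by rewrite !levelM tn level_swap level_tpow; case: b.
(* Being in [K], the conjugate of [k] by [y] fixes [(n, true, 1)]. Computed through the sheet
   [false], where [k] multiplies, the last coordinate is instead [k] conjugated by [t^n], which must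
   therefore be 1. *)
have := stdK _ (normal_conj y nK Kk) true 1.
have -> : level (y * k * y^-1) (Posz n, true, 1) =
    level y (level k (Posz n, false, gen t ^+ n)).
  rewrite (levelM (y * k)) (levelM y k); congr (level _ (level _ _)).
  by rewrite -[RHS](levelVK y) yE /= mulVg.
rewrite stdK // yE => -[/eqP]; rewrite mulgA; set c := gen t ^+ n.
have -> : c^-1 * k * c = k ^ c by rewrite /conjg mulgA.
by rewrite conjg_eq1 => /eqP.
Qed.

End KernelCase.

(** * Derivations into twisted permutation modules *)

Section FiniteSupport.
Variable Q : choiceType.
Local Open Scope ring_scope.
Implicit Types f : Q -> rat.

Definition finsupp f : Prop := finite_set [set q | f q != 0].

(** By convention this sum is 0 when the support of [f] is infinite. *)
Definition total f : rat := \sum_(q \in [set: Q]) f q.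

Lemma totalE (D : set Q) f : [set q | f q != 0] `<=` D ->
  total f = \sum_(q \in D) f q.
Proof.
move=> fD; apply/esym/fsbig_widen => // q [_ /= Dq]; apply/eqP.
by apply: contra_notT Dq => /fD.
Qed.

Lemma finsupp0 : finsupp 0.
Proof.
by rewrite /finsupp (_ : [set _ | _] = set0) // -subset0 => q /= /eqP [].
Qed.

Lemma finsuppD f1 f2 : finsupp f1 -> finsupp f2 -> finsupp (f1 + f2).
Proof.
move=> f1f f2f;
apply: (@sub_finite_set _ _ ([set q | f1 q != 0] `|` [set q | f2 q != 0])).
  move=> q /=; rewrite fctE; have [->|] := eqVneq (f1 q) 0; last by left.
  by rewrite add0r; right.
by rewrite finite_setU.
Qed.

Lemma finsuppN f : finsupp f -> finsupp (- f).
Proof. by apply: sub_finite_set => q /=; rewrite oppr_eq0. Qed.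

Lemma finsuppZ (c : rat) f : finsupp f -> finsupp (fun q => c * f q).
Proof.
by apply: sub_finite_set => q /=; rewrite mulf_eq0 negb_or => /andP[].
Qed.

Lemma totalD f1 f2 : finsupp f1 -> finsupp f2 ->
  total (f1 + f2) = total f1 + total f2.
Proof.
move=> f1f f2f; pose D := [set q | f1 q != 0] `|` [set q | f2 q != 0].
have finD : finite_set D by rewrite finite_setU.
rewrite !(@totalE D) //; first exact: fsbig_split.
- by move=> q; right.
- by move=> q; left.
- move=> q /=; rewrite fctE; have [->|] := eqVneq (f1 q) 0; last by left.
  by rewrite add0r; right.
Qed.

Lemma totalZ (c : rat) f : total (fun q => c * f q) = c * total f.
Proof. by rewrite /total mulr_fsumr. Qed.

Lemma totalN f : total (- f) = - total f.
Proof.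
rewrite -[RHS]mulN1r -totalZ; congr total.
by apply/funext => q; rewrite mulN1r.
Qed.

Lemma total_reindex (s : Q -> Q) f : bijective s -> total (f \o s) = total f.
Proof. by move=> bs; rewrite /total; exact/esym/reindex_fsbigT. Qed.

Definition indic1 (q : Q) : Q -> rat := fun q' => (q' == q)%:R.

Lemma finsupp_indic1 q : finsupp (indic1 q).
Proof.
apply: (@sub_finite_set _ _ [set q]); last exact: finite_set1.
by move=> q' /=; apply: contra_neqP => /eqP/negbTE qq; rewrite /indic1 qq.
Qed.

Lemma total_indic1 q : total (indic1 q) = 1.
Proof.
rewrite (@totalE [set q]) ?fsbig_set1 /indic1 ?eqxx //.
by move=> q' /=; apply: contra_neqP => /eqP/negbTE ->.
Qed.

End FiniteSupport.

Section TwistedPermutationModule.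
Variables (G : groupType) (Q : choiceType) (op : G -> Q -> Q).
Hypothesis op1 : forall q, op 1 q = q.
Hypothesis opM : forall x y q, op (x * y) q = op x (op y q).
Variable mu : G -> rat.
Hypothesis mu1 : mu 1 = 1%R.
Hypothesis muM : forall x y, mu (x * y) = (mu x * mu y)%R.
Implicit Types (x y : G) (f : Q -> rat).

Lemma opVK x q : op x^-1 (op x q) = q.
Proof. by rewrite -opM mulVg op1. Qed.

Lemma opKV x q : op x (op x^-1 q) = q.
Proof. by rewrite -opM mulgV op1. Qed.

Lemma mu_neq0 x : mu x != 0%R.
Proof.
apply/eqP => x0; have : mu (x * x^-1) = 1%R by rewrite mulgV.
by rewrite muM x0 mul0r.
Qed.

Lemma muV x : mu x^-1 = (mu x)^-1%R.
Proof.
by apply: (mulfI (mu_neq0 x)); rewrite -muM mulgV mu1 mulfV // mu_neq0.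
Qed.

Definition twist x f : Q -> rat := fun q => (mu x * f (op x^-1 q))%R.

Lemma twist1 f : twist 1 f = f.
Proof. by apply/funext => q; rewrite /twist invg1 op1 mu1 mul1r. Qed.

Lemma twistM x y f : twist (x * y) f = twist x (twist y f).
Proof. by apply/funext => q; rewrite /twist muM invgM opM mulrA. Qed.

Lemma twist0 x : twist x 0%R = 0%R.
Proof. by apply/funext => q; rewrite /twist mulr0. Qed.

Lemma twistD x f1 f2 : twist x (f1 + f2)%R = (twist x f1 + twist x f2)%R.
Proof. by apply/funext => q; rewrite /twist mulrDr. Qed.

Lemma twistN x f : twist x (- f)%R = (- twist x f)%R.
Proof. by apply/funext => q; rewrite /twist mulrN. Qed.

Lemma twistK x f : twist x^-1 (twist x f) = f.
Proof. by rewrite -twistM mulVg twist1. Qed.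

Lemma twistVK x f : twist x (twist x^-1 f) = f.
Proof. by rewrite -twistM mulgV twist1. Qed.

Lemma finsupp_twist x f : finsupp f -> finsupp (twist x f).
Proof.
move=> ff; apply: (@sub_finite_set _ _ (op x @` [set q | f q != 0%R])).
  move=> q /=; rewrite /twist mulf_eq0 negb_or => /andP[_ fq].
  by exists (op x^-1 q); rewrite ?opKV.
exact: finite_image.
Qed.

(** Thus [total] is equivariant towards the one-dimensional module of [mu], which turns identities
    between functions into identities between numbers. *)
Lemma total_twist x f : total (twist x f) = (mu x * total f)%R.
Proof.
rewrite totalZ; congr (_ * _)%R; apply: (total_reindex (s := op x^-1)).
exists (op x) => q; [exact: opKV|exact: opVK].
Qed.

Section Derivation.
Variables (K : set G) (d : G -> Q -> rat) (s : G).
Hypothesis nK : normal_subgroup K.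
Hypothesis fgK : finitely_generated K.
Hypothesis opK : forall k q, K k -> op k q = q.
Hypothesis orbit_infinite :
  forall (D : set Q) q, finite_set D -> exists x, ~ D (op x q).
Hypothesis dM : forall x y, d (x * y) = (d x + twist x (d y))%R.
Hypothesis finsupp_d : forall x, finsupp (d x).
Hypothesis Ks : K s.
Hypothesis mus : mu s != 1%R.

Let sK : subgroup K. Proof. by case: nK. Qed.

Let twistK k f : K k -> twist k f = (fun q => mu k * f q)%R.
Proof.
by move=> Kk; apply/funext => q; rewrite /twist opK //; apply: subgroupV.
Qed.

Let d1 : d 1 = 0%R.
Proof.
have := dM 1 1; rewrite mulg1 twist1 => /eqP.
by rewrite -subr_eq0 opprD addrA subrr sub0r oppr_eq0 => /eqP.
Qed.

Let dV x : d x^-1 = (- twist x^-1 (d x))%R.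
Proof.
by apply/eqP; rewrite -addr_eq0 -dM mulVg d1.
Qed.

(** Elements of [K] act by scalars, so for fixed [q] the [k] in [K] with [d k q = 0] form a
    subgroup. It is all of [K] as soon as [q] avoids the supports of [d] on the finitely many
    generators. *)
Lemma derivation_support_finite :
  exists2 D : set Q, finite_set D & forall k q, K k -> ~ D q -> d k q = 0%R.
Proof.
have [A finA KA] := fgK.
exists (\bigcup_(x in A) [set q | d x q != 0%R]).
  by apply: bigcup_finite => // x _; exact: finsupp_d.
move=> k q Kk Dq; have AK x : A x -> K x by rewrite KA; exact: sub_gen_smallest.
pose P k := K k /\ d k q = 0%R.
suff: P k by case.
move: k Kk; rewrite {1}KA; apply: (@smallest_subgroup_ind _ A P).
- by split; [exact: subgroup1|rewrite d1].
- move=> x y [Kx dx] [Ky dy]; have KVy := subgroupV sK Ky.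
  split; first exact: subgroupM.
  by rewrite dM dV !twistK // !fctE dx dy mulr0 oppr0 mulr0 addr0.
- move=> x Ax; split; first exact: AK.
  by apply/eqP/negPn/negP => dx; apply: Dq; exists x.
Qed.

(* d (x k x^-1) = x d k when mu k = 1 : the support of d k is carried by every
   x into a fixed finite set, whereas orbits are infinite. *)
Lemma derivation_ker_eq0 k : K k -> mu k = 1%R -> d k = 0%R.
Proof.
move=> Kk muk; have [D finD dD] := derivation_support_finite.
have dconj x : d (x * k * x^-1) = twist x (d k).
  rewrite -mulgA dM dM twistD dV twistN (twistK _ Kk) muk twistN addrCA.
  rewrite (_ : (fun q => _) = twist x^-1 (d x)) ?twistVK ?subrr ?addr0 //.
  by apply/funext => q; rewrite mul1r.
apply/funext => q; have [x Dx] := orbit_infinite q finD.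
have := dD _ _ (normal_conj x nK Kk) Dx; rewrite dconj /twist opVK => /eqP.
by rewrite mulf_eq0 (negbTE (mu_neq0 x)) => /eqP.
Qed.

(** The commutator [e] of [x] and [s] lies in [K] and in the kernel of [mu], so [d e = 0] and
    [d (x * s) = d (s * x)]. Expanding both sides gives [(1 - mu s) d x = d s - x (d s)], whence the
    choice of [m]. *)
Lemma derivation_principal :
  exists2 m, finsupp m & forall x, d x = (m - twist x m)%R.
Proof.
exists (fun q => (1 - mu s)^-1 * d s q)%R; first exact: finsuppZ.
have mus' : (1 - mu s)%R != 0%R by rewrite subr_eq0 eq_sym.
move=> x; pose e := x * s * x^-1 * s^-1.
have Ke : K e by apply: subgroupM => //; [exact: normal_conj|exact: subgroupV].
have mue : mu e = 1%R.
  by rewrite !muM !muV mulrAC mulfK ?mu_neq0 // mulfV ?mu_neq0.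
have := dM e (s * x); rewrite (derivation_ker_eq0 Ke mue) add0r twistK // mue.
rewrite (_ : e * _ = x * s); last by rewrite /e !mulgA !mulgVK.
rewrite !dM (twistK _ Ks) => dxs; apply/funext => q.
have := congr1 (@^~ q) dxs; rewrite !fctE mul1r /twist => dq.
apply: (mulfI mus'); rewrite mulrBr mulVKf // mulrCA mulVKf //.
by rewrite mulrBl mul1r; apply/eqP; rewrite subr_eq addrAC eq_sym subr_eq -dq addrC.
Qed.

End Derivation.
End TwistedPermutationModule.

(** * Poincare duality *)

Section Duality.
Variable h : nat.
Local Notation g := h.+2.
Local Notation G := (surface_group g).
Local Notation gen := (@presented_gen (surface_gen g) [set surface_relator g]).
Local Notation cls := (presented_class [set surface_relator g]).
Local Notation t := (inr ord0 : surface_gen g).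

Definition mu (x : G) : rat := ((2%:R : rat) ^ chi x)%R.

Lemma mu1 : mu 1 = 1%R.
Proof. by rewrite /mu chi1 expr0z. Qed.

Lemma muM x y : mu (x * y) = (mu x * mu y)%R.
Proof. by rewrite /mu chiM expfzDr. Qed.

(** An action on the rational line by affine maps with linear part [mu x^-1] (see [affineE]); its
    translation part provides [theta]. Each commutator [[a_i, b_i]] acts trivially because [a_i] or
    [b_i] does. *)
Definition affine_letter (l : surface_gen g * bool) (z : rat) : rat :=
  (if l.1 == t then if l.2 then z * 2%:R else z / 2%:R
   else if l.1 == inl (second h) then if l.2 then z - 1 else z + 1 else z)%R.

Lemma affine_letterK l z : affine_letter l (affine_letter (inv_letter l) z) = z.
Proof.
case: l => x e; rewrite /affine_letter /=.
by case: (x == t); [|case: (_ == _)]; case: e => //=;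
  rewrite ?mulfVK ?mulfK ?addrK ?subrK //.
Qed.

Lemma affine_inl (i : 'I_g) e z : affine_letter (inl i, e) z =
  if i == second h then (if e then z - 1 else z + 1)%R else z.
Proof. by []. Qed.

Lemma affine_inr (i : 'I_g) e z : affine_letter (inr i, e) z =
  if i == ord0 then (if e then z * 2%:R else z / 2%:R)%R else z.
Proof. by []. Qed.

Lemma affine_comm (i : 'I_g) z : foldr affine_letter z (surface_comm i) = z.
Proof.
rewrite /surface_comm /foldr !affine_inl; case: (eqVneq i (second h)) => [->|_].
  by rewrite !affine_inr /= subrK.
exact: (affine_letterK (inr i, false)).
Qed.

Lemma affine_comms (s : seq 'I_g) z :
  foldr affine_letter z (flatten [seq surface_comm i | i <- s]) = z.
Proof.
elim: s => //= i s IH.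
by have := affine_comm i z; rewrite /= IH.
Qed.

Lemma affine_relator r z :
  [set surface_relator g] r -> foldr affine_letter z r = z.
Proof. by move=> ->; exact: affine_comms. Qed.

Definition affine (x : G) : rat -> rat := presented_act affine_letter x.

Lemma affine1 z : affine 1 z = z.
Proof. exact: (presented_act1 affine_letterK affine_relator). Qed.

Lemma affineM x y z : affine (x * y) z = affine x (affine y z).
Proof. exact: (presented_actM affine_letterK affine_relator). Qed.

Lemma affine_class w z : affine (cls w) z = foldr affine_letter z w.
Proof. exact: (presented_act_class affine_letterK affine_relator). Qed.

Lemma affine_gen x z : affine (gen x) z = affine_letter (x, false) z.
Proof. exact: (presented_act_gen affine_letterK affine_relator). Qed.

Lemma affine_genV x z : affine (gen x)^-1 z = affine_letter (x, true) z.
Proof. exact: (presented_act_genV affine_letterK affine_relator). Qed.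

Lemma affineE x z : affine x z = (affine x 0 + mu x^-1 * z)%R.
Proof.
elim/presented_ind: x z => [|x y IHx IHy|x IHx|x] z.
- by rewrite !affine1 invg1 mu1 mul1r add0r.
- rewrite !affineM IHy (IHx (_ + _)%R) (IHx (affine y 0)) invgM muM.
  by rewrite mulrDr addrA mulrA (mulrC (mu y^-1)).
- have m0 : (mu x^-1 != 0)%R by apply: mu_neq0; [exact: mu1|exact: muM].
  have xV : (mu x^-1)^-1%R = mu x by rewrite -(muV mu1 muM) invgK.
  have e y : affine x^-1 y = (mu x * (y - affine x 0))%R.
    rewrite -{1}[y](_ : affine x (mu x * (y - affine x 0))%R = y).
      by rewrite -affineM mulVg affine1.
    by rewrite IHx -xV mulVKf // addrC subrK.
  by rewrite !e invgK sub0r mulrDr addrC.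
- rewrite !affine_gen /affine_letter /= /mu chiV chi_gen.
  case: eqP => _; first by rewrite mul0r add0r mulrC.
  by rewrite oppr0 expr0z mul1r; case: eqP => _; rewrite ?add0r // addrC.
Qed.

(* The right derivation with theta a_1 = -1 that vanishes on the other
   generators. *)
Definition theta (x : G) : rat := affine x^-1 0.

Lemma theta1 : theta 1 = 0%R. Proof. by rewrite /theta invg1 affine1. Qed.

Lemma thetaM x y : theta (x * y) = (theta y + mu y * theta x)%R.
Proof. by rewrite /theta invgM affineM affineE invgK. Qed.

(** * Fox calculus for the surface relator with values in the twisted module *)

Section Fox.
Variables (Q : choiceType) (op : G -> Q -> Q).
Hypothesis op1 : forall q, op 1 q = q.
Hypothesis opM : forall x y q, op (x * y) q = op x (op y q).
Local Notation tw := (twist op mu).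
Implicit Types (v : surface_gen g -> Q -> rat) (f : Q -> rat).

Let twM := twistM opM muM.
Let tw1 := twist1 op1 mu1.
Let twK := twistK op1 opM mu1 muM.
Let twVK := twistVK op1 opM mu1 muM.

(** The affine action of the free group on functions with translation part [v]. The image of 0 under
    a word, [fox v w], is the value at [w] of the derivation taking the values [v] on the
    generators. *)
Definition fox_letter v (l : surface_gen g * bool) f : Q -> rat :=
  (if l.2 then tw (gen l.1)^-1 (f - v l.1) else v l.1 + tw (gen l.1) f)%R.

Definition fox v (w : word (surface_gen g)) : Q -> rat :=
  foldr (fox_letter v) 0%R w.

Lemma fox_letterK v l f : fox_letter v l (fox_letter v (inv_letter l) f) = f.
Proof.
case: l => x [] /=; rewrite /fox_letter /=.
  by rewrite addrC addKr twK.
by rewrite twVK addrC subrK.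
Qed.

Lemma foldr_fox v w f :
  foldr (fox_letter v) f w = (fox v w + tw (cls w) f)%R.
Proof.
rewrite /fox; elim: w => [|[x e] w IH] /=; first by rewrite tw1 add0r.
rewrite IH presented_class_cons twM; case: e => //=; rewrite /fox_letter /=.
  by rewrite addrAC !twistD.
by rewrite twistD addrA.
Qed.

Lemma foxD v1 v2 w :
  fox (fun x => v1 x + v2 x)%R w = (fox v1 w + fox v2 w)%R.
Proof.
rewrite /fox; elim: w => [|[x e] w IH] /=; first by rewrite addr0.
rewrite IH /fox_letter; case: e => /=; last by rewrite twistD addrACA.
by rewrite -twistD opprD addrACA.
Qed.

Lemma foxN v w : fox (fun x => - v x)%R w = (- fox v w)%R.
Proof.
rewrite /fox; elim: w => [|[x e] w IH] /=; first by rewrite oppr0.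
by rewrite IH /fox_letter; case: e => /=; rewrite -?opprD twistN // opprD.
Qed.

Lemma fox_cat v w1 w2 : fox v (w1 ++ w2) = (fox v w1 + tw (cls w1) (fox v w2))%R.
Proof. by rewrite {1}/fox foldr_cat foldr_fox. Qed.

Lemma fox_eq0 v w : (forall l, l \in w -> v l.1 = 0%R) -> fox v w = 0%R.
Proof.
rewrite /fox; elim: w => //= l w IH w0.
rewrite IH => [|l' l'w]; last by apply: w0; rewrite inE l'w orbT.
by rewrite /fox_letter w0 ?mem_head // subrr !twist0 addr0 if_same.
Qed.

(** With this choice, [fox (single y f) w] is the Fox derivative of [w] with respect to [y], applied
    to [f]. *)
Definition single (y : surface_gen g) f : surface_gen g -> Q -> rat :=
  fun x => if x == y then f else 0%R.

(** Only the commutator of index [i] involves [y]: the others contribute 0, and those before it act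
    through their class. *)
Lemma fox_single (y : surface_gen g) (s s' : seq 'I_g) i f :
  enum 'I_g = s ++ i :: s' -> y = inl i \/ y = inr i ->
  fox (single y f) (surface_relator g) =
  tw (cls (flatten [seq surface_comm j | j <- s])) (fox (single y f) (surface_comm i)).
Proof.
move=> es yi.
have : uniq (s ++ i :: s') by rewrite -es enum_uniq.
rewrite cat_uniq /= negb_or => /and4P[_ /andP[is_ _] is' _].
have comm0 r : i \notin r ->
    fox (single y f) (flatten [seq surface_comm j | j <- r]) = 0%R.
  move=> ir; apply: fox_eq0 => l /flattenP[_ /mapP[j jr ->] lj].
  have ji : (j == i) = false by apply: contraNF ir => /eqP <-.
  rewrite /single; case: eqP => // ly; move: lj; rewrite !inE.
  by case: yi => yi; case/or4P => /eqP lE; move: ly; rewrite lE yi /= => -[] /eqP;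
    rewrite ?ji.
have rE : surface_relator g = flatten [seq surface_comm j | j <- s] ++
    surface_comm i ++ flatten [seq surface_comm j | j <- s'].
  by rewrite /surface_relator es map_cat flatten_cat.
rewrite [in fox _ (surface_relator g)]rE !fox_cat comm0 // add0r.
by rewrite (comm0 s') // twist0 addr0.
Qed.

(** The function [f - x f] is the coboundary of a 1-cochain [v] whose value at [b_1] has a
    prescribed total. When [x] fixes [f], this [v] extends to a derivation of [G]. *)
Definition bounds (x : G) : Prop := forall f, finsupp f ->
  exists v, [/\ forall y, finsupp (v y),
    fox v (surface_relator g) = (f - tw x f)%R &
    total (v (inr (second h))) = (theta x * total f)%R].

Lemma bounds1 : bounds 1.
Proof.
move=> f _; exists (fun=> 0%R); split; first by move=> _; exact: finsupp0.
  by rewrite tw1 subrr fox_eq0.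
by rewrite theta1 mul0r /total fsbig1.
Qed.

(** Split [f - x y f] as [(y f - x (y f)) + (f - y f)]; the totals add up by the rule [thetaM]. *)
Lemma boundsM x y : bounds x -> bounds y -> bounds (x * y).
Proof.
move=> bx by_ f ff.
have [v1 [v1f v1r v1t]] := bx _ (finsupp_twist op1 opM mu y ff).
have [v2 [v2f v2r v2t]] := by_ _ ff.
exists (fun z => v1 z + v2 z)%R; split; first by move=> z; exact: finsuppD.
  by rewrite foxD v1r v2r twM addrC subrKA.
rewrite totalD // v1t v2t (total_twist op1 opM) thetaM mulrDl mulrCA mulrA.
by rewrite addrC.
Qed.

Lemma boundsV x : bounds x -> bounds x^-1.
Proof.
move=> bx f ff; have [v [vf vr vt]] := bx _ (finsupp_twist op1 opM mu x^-1 ff).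
exists (fun z => - v z)%R; split; first by move=> z; exact: finsuppN.
  by rewrite foxN vr twVK opprB.
rewrite totalN vt (total_twist op1 opM) mulrA -mulNr; congr (_ * _)%R.
apply/eqP; rewrite eq_sym -addr_eq0 mulrC -thetaM mulgV.
exact/eqP/theta1.
Qed.

Section Generators.
Variables (s s' : seq 'I_g) (i : 'I_g).
Hypothesis es : enum 'I_g = s ++ i :: s'.
Local Notation P := (cls (flatten [seq surface_comm j | j <- s])).
Local Notation a := (gen (inl i)).
Local Notation b := (gen (inr i)).

Lemma finsupp_single y f z : finsupp f -> finsupp (single y f z).
Proof. by move=> ff; rewrite /single; case: eqP => _ //; exact: finsupp0. Qed.

Let affP z : affine P z = z. Proof. by rewrite affine_class affine_comms. Qed.
Let affPV z : affine P^-1 z = z.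
Proof. by rewrite -{1}[z]affP -affineM mulVg affine1. Qed.

(** The Fox derivative of the relator with respect to [a] is [P (1 - a b a^-1)], that is
    [(1 - beta) P] for the element [beta] of the statement; hence the witness [P^-1 f]. Moreover
    [theta beta = 0]. *)
Lemma bounds_beta : bounds (P * a * b * a^-1 * P^-1).
Proof.
move=> f ff; exists (single (inl i) (tw P^-1 f)); split.
- by move=> y; apply: finsupp_single; exact: finsupp_twist.
- rewrite (fox_single _ es); last by left.
  rewrite /fox /surface_comm /foldr /fox_letter /single /= eqxx.
  rewrite !subr0 !twist0 sub0r !twistN add0r !twistD !twistN twVK.
  by rewrite -!twM.
- rewrite /single /= /total fsbig1 //; apply/esym.
  rewrite /theta !invgM !invgK !mulgA !affineM affPV affP.
  rewrite affine_genV affine_gen affine_genV !affine_inl !affine_inr.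
  have [->|_] := eqVneq i (second h); first by rewrite /= sub0r addNr mul0r.
  by rewrite mul0r if_same mul0r.
Qed.

(** The Fox derivative with respect to [b] is [P (a - a b a^-1 b^-1)], that is [(1 - alpha) P a];
    hence the witness [(P a)^-1 f]. Here [theta alpha] is 1 for the index of [b_1] and 0
    otherwise. *)
Lemma bounds_alpha : bounds (P * a * b * a^-1 * b^-1 * a^-1 * P^-1).
Proof.
move=> f ff; exists (single (inr i) (tw (P * a)^-1 f)); split.
- by move=> y; apply: finsupp_single; exact: finsupp_twist.
- rewrite (fox_single _ es); last by right.
  rewrite /fox /surface_comm /foldr /fox_letter /single /= eqxx.
  rewrite sub0r add0r subr0 !twistN !twistD !twistN -!twM mulgV tw1.
  by rewrite invgM !mulgA.
- rewrite /theta !invgM !invgK !mulgA !affineM affPV affP.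
  rewrite !affine_genV !affine_gen !affine_inl !affine_inr /single.
  have [->|ib] := eqVneq i (second h).
    rewrite eqxx (total_twist op1 opM) /=; congr (_ * _)%R.
    (* [P] acts as the identity on the line, and [mu P^-1] is its linear part. *)
    have muP : mu P^-1 = 1%R.
      by have := affineE P 1; rewrite !affP mulr1 add0r.
    by rewrite muM muP mulr1 /mu chiV chi_gen /= sub0r addNr add0r.
  have -> : (inr (second h) == inr i :> surface_gen g) = false.
    by apply: contraNF ib => /eqP[->].
  by rewrite /total fsbig1 // !(mul0r, if_same).
Qed.

End Generators.

(** Induction along the commutators: once the prefix [P] is known to satisfy [bounds], [a] and [b]
    are words in [P], [alpha] and [beta], and then the next prefix [P [a, b]] satisfies it too. *)
Lemma bounds_gen i : bounds (gen (inl i)) /\ bounds (gen (inr i)).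
Proof.
suff H s' s : enum 'I_g = s ++ s' ->
    bounds (cls (flatten [seq surface_comm j | j <- s])) ->
    forall j, j \in s' -> bounds (gen (inl j)) /\ bounds (gen (inr j)).
  by apply: (H (enum 'I_g) [::]) => //; [exact: bounds1|rewrite mem_enum].
elim: s' s => // j s' IH s es bP.
set P := cls _ in bP; pose a := gen (inl j); pose b := gen (inr j).
have bbeta : bounds (P * a * b * a^-1 * P^-1) := bounds_beta es.
have balpha : bounds (P * a * b * a^-1 * b^-1 * a^-1 * P^-1) := bounds_alpha es.
set beta := P * a * b * a^-1 * P^-1 in bbeta.
set alpha := P * a * _ * _ * _ * _ * _ in balpha.
have ba : bounds a.
  have -> : a = P^-1 * (beta^-1 * alpha^-1 * beta) * P.
    by rewrite /alpha /beta !gnorm.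
  by do ![assumption|apply: boundsV|apply: boundsM].
have bb : bounds b.
  have -> : b = a^-1 * P^-1 * beta * P * a by rewrite /beta !gnorm.
  by do ![assumption|apply: boundsV|apply: boundsM].
move=> k; rewrite inE => /orP[/eqP -> //|]; apply: (IH (rcons s j)).
  by rewrite cat_rcons.
rewrite map_rcons flatten_rcons presented_class_cat surface_comm_class.
by do ![assumption|apply: boundsV|apply: boundsM].
Qed.

(* Poincare duality: f - x f is a boundary in the chain complex of the
   generators P a b a^-1 P^-1 and P a b a^-1 b^-1 a^-1 P^-1, and this complex
   is dual to the complex of the presentation. *)
Lemma bounds_all x : bounds x.
Proof.
elim/presented_ind: x => [|x y|x|[]i]; [exact: bounds1|exact: boundsM|exact: boundsV| |];
  by case: (bounds_gen i).
Qed.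

Section Derivation.
Variable v : surface_gen g -> Q -> rat.
Hypothesis finsupp_v : forall y, finsupp (v y).
Hypothesis vr : fox v (surface_relator g) = 0%R.

Lemma fox_relator r f :
  [set surface_relator g] r -> foldr (fox_letter v) f r = f.
Proof.
move=> rr; rewrite foldr_fox (presented_relator rr) tw1.
by rewrite rr vr add0r.
Qed.

Definition fox_deriv (x : G) : Q -> rat :=
  presented_act (fox_letter v) x 0%R.

Lemma fox_deriv_class w : fox_deriv (cls w) = fox v w.
Proof. exact: (presented_act_class (fox_letterK v) fox_relator). Qed.

Lemma fox_derivM x y : fox_deriv (x * y) = (fox_deriv x + tw x (fox_deriv y))%R.
Proof.
elim/presentedW: x => u; elim/presentedW: y => w.
by rewrite -presented_class_cat !fox_deriv_class fox_cat.
Qed.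

Lemma fox_deriv_gen y : fox_deriv (gen y) = v y.
Proof. by rewrite fox_deriv_class /fox /= /fox_letter /= twist0 addr0. Qed.

Lemma finsupp_fox_deriv x : finsupp (fox_deriv x).
Proof.
elim/presentedW: x => w; rewrite fox_deriv_class /fox.
elim: w => [|l w IH] /=; first exact: finsupp0.
rewrite /fox_letter; case: l.2; first apply: finsupp_twist => //.
  by apply: finsuppD => //; exact: finsuppN.
by apply: finsuppD => //; exact: finsupp_twist.
Qed.

End Derivation.

Lemma chi_eq0_of_fg (K : set G) (q0 : Q) : normal_subgroup K ->
  finitely_generated K -> (forall k q, K k -> op k q = q) ->
  (forall (D : set Q) q, finite_set D -> exists x, ~ D (op x q)) ->
  forall s, K s -> chi s = 0%R.
Proof.
move=> nK fgK opK orbits s Ks; apply/eqP/negPn/negP => s0.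
have mus : mu s != 1%R by rewrite /mu pexprz_eq1 // negb_or s0.
have sK : subgroup K by case: nK.
pose a := gen (inl (second h)); pose e := s * (a * s^-1 * a^-1).
have Ke : K e.
  by apply: subgroupM => //; apply: normal_conj => //; exact: subgroupV.
have nz := mu_neq0 mu1 muM.
have mue : mu e = 1%R by rewrite !muM !(muV mu1 muM) mulrAC !mulfV // mul1r mulfV.
have twe f : tw e f = f.
  apply/funext => q; rewrite /twist opK; last exact: subgroupV.
  by rewrite mue mul1r.
(* Since [e] acts trivially on the module, [v] kills the relator and defines a derivation. *)
have [v [vf vr vt]] := bounds_all e (finsupp_indic1 q0).
rewrite twe subrr in vr.
have [m mf dm] := derivation_principal op1 opM mu1 muM nK fgK opK orbits
  (fox_derivM vr) (finsupp_fox_deriv vf vr) Ks mus.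
(* The total at [b_1] is [theta e] on one side and a multiple of [1 - mu b_1 = 0] on the other; what
   follows computes [theta e = 1 - mu s^-1]. *)
have := congr1 (@total Q) (dm (gen (inr (second h)))).
rewrite (fox_deriv_gen vr) vt total_indic1 mulr1 totalD //; last first.
  by apply: finsuppN; exact: finsupp_twist.
rewrite totalN (total_twist op1 opM) {1}/mu chi_gen expr0z mul1r subrr.
apply/eqP; rewrite /theta /e !invgM !invgK !affineM.
set z := affine s^-1 0; have sz : affine s z = 0%R.
  by rewrite -affineM mulgV affine1.
have -> : affine a^-1 z = (z - 1)%R by rewrite affine_genV affine_inl eqxx.
have -> : affine s (z - 1)%R = (- mu s^-1)%R.
  by rewrite affineE mulrBr mulr1 addrA -affineE sz sub0r.
rewrite affine_gen affine_inl eqxx addrC subr_eq0 (muV mu1 muM).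
by rewrite eq_sym invr_eq1.
Qed.

End Fox.
End Duality.

Local Open Scope quotient_scope.

(** * The translation action on G/K *)

Section CosetAction.
Variables (G : groupType) (K : set G).
Hypothesis nK : normal_subgroup K.

Let sK : subgroup K. Proof. by case: nK. Qed.

Definition coset_rel : rel G := fun x y => `[< K (x^-1 * y) >].

Lemma coset_rel_refl : reflexive coset_rel.
Proof. by move=> x; apply/asboolP; rewrite mulVg; exact: subgroup1. Qed.

Lemma coset_rel_sym : symmetric coset_rel.
Proof.
by move=> x y; apply/asboolP/asboolP => /(subgroupV sK); rewrite invgM invgK.
Qed.

Lemma coset_rel_trans : transitive coset_rel.
Proof.
move=> y x z /asboolP xy /asboolP yz; apply/asboolP.
by have := subgroupM sK xy yz; rewrite mulgA mulgK.
Qed.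

Definition coset_equiv :=
  EquivRel coset_rel coset_rel_refl coset_rel_sym coset_rel_trans.

(** A quotient type instead of a set of cosets, so that G/K is a [choiceType] and can index the
    twisted module. *)
Definition coset := {eq_quot coset_equiv}.

HB.instance Definition _ := Choice.on coset.

Definition coset_of (x : G) : coset := \pi_({eq_quot coset_equiv}) x.

Definition coset_op (x : G) (q : coset) : coset := coset_of (x * repr q).

Lemma coset_of_eqP x y : coset_of x = coset_of y <-> K (x^-1 * y).
Proof. by split=> [/eqmodP/asboolP|Kxy]; last exact/eqmodP/asboolP. Qed.

Lemma coset_of_repr q : coset_of (repr q) = q.
Proof. exact: reprK. Qed.

Lemma coset_opE x y : coset_op x (coset_of y) = coset_of (x * y).
Proof.
apply/coset_of_eqP; rewrite invgM -mulgA mulKg; apply/coset_of_eqP.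
exact: coset_of_repr.
Qed.

Lemma coset_op1 q : coset_op 1 q = q.
Proof. by rewrite -(coset_of_repr q) coset_opE mul1g. Qed.

Lemma coset_opM x y q : coset_op (x * y) q = coset_op x (coset_op y q).
Proof. by rewrite -(coset_of_repr q) !coset_opE mulgA. Qed.

Lemma coset_op_id k q : K k -> coset_op k q = q.
Proof.
move=> Kk; rewrite -(coset_of_repr q) coset_opE; apply/coset_of_eqP.
have := normal_conj (repr q)^-1 nK (subgroupV sK Kk).
by rewrite invgM invgK.
Qed.

Lemma left_coset_repr x : left_coset K (repr (coset_of x)) = left_coset K x.
Proof.
have /coset_of_eqP Kx := coset_of_repr (coset_of x).
rewrite eqEsubset; split=> _ [k Kk <-].
  exists (x^-1 * repr (coset_of x) * k); last by rewrite !mulgA mulgV mul1g.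
  by apply: subgroupM => //; have := subgroupV sK Kx; rewrite invgM invgK.
exists ((repr (coset_of x))^-1 * x * k); first exact: subgroupM.
by rewrite !mulgA mulgV mul1g.
Qed.

(** The action is transitive: a finite set containing one orbit would contain every coset. *)
Lemma coset_orbit_infinite : infinite_index K ->
  forall (D : set coset) q, finite_set D -> exists x, ~ D (coset_op x q).
Proof.
move=> infK D q finD; apply/not_existsP => /= DK; apply: infK.
apply: sub_finite_set (finite_image (fun q => left_coset K (repr q)) finD).
move=> _ [x _ <-]; exists (coset_of x); last exact: left_coset_repr.
have := DK (x * (repr q)^-1); rewrite /coset_op mulgVK.
by move=> H; apply: contra_notP H.
Qed.

End CosetAction.

Theorem lemma3p4 (g : nat) (hg : 2 <= g) : NINF (surface_group g).
Proof.
case: g hg => [|[|h]] // _ K nK K1 infK fgK; apply: K1.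
have opK k (q : coset nK) (Kk : K k) : coset_op k q = q := coset_op_id q Kk.
(* Taking G/K for [Q], finite generation first forces [chi] to vanish on [K], and then [K] to be
   trivial. *)
have chi0 := chi_eq0_of_fg (@coset_op1 _ _ nK) (@coset_opM _ _ nK)
  (coset_of nK 1) nK fgK opK (coset_orbit_infinite infK).
exact: normal_fg_in_ker_chi nK fgK chi0.
Qed.
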